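(* Suppose that $S$ and $T$ are sets of points in a finite affine plane $A_q$ of order $q$ and that the number of directions cross-determined by $(S,T)$ equals $c\le\frac{q+1}{2}$. Then $|S||T|\le q^2$. If $|S||T|=q^2$, then $S=T$ is a set of $q$ points determining $c$ directions.
   Context: $A_q$ is an arbitrary (not necessarily Desarguesian) affine plane of order $q$. A direction is a parallel class of lines (equivalently, a point of the line at infinity of the projective completion); there are $q+1$ directions, and a line has direction $(d)$ if it belongs to that parallel class. A pair $(S,T)$ of point sets cross-determines a direction $(d)$ if there are distinct points $P\in S$ and $Q\in T$ such that the line $PQ$ has direction $(d)$. A point set $S$ determines a direction $(d)$ if there are distinct points $P,Q\in S$ such that the line $PQ$ has direction $(d)$. The sets $S$ and $T$ are not required to be disjoint. *)

(* Defs.v *)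
From mathcomp Require Import all_boot.

Set Implicit Arguments.
Unset Strict Implicit.
Unset Printing Implicit Defensive.

Definition parallel (P : finType) (l m : {set P}) : bool :=
  (l == m) || [disjoint l & m].

(* Lines are identified with their sets of points. *)
Record affine_plane := AffinePlane {
  point : finType;
  lines : {set {set point}};
  unique_line : forall x y : point, x != y ->
        exists! l : {set point}, [/\ l \in lines, x \in l & y \in l];
  unique_parallel : forall (l : {set point}) (x : point), l \in lines -> x \notin l ->
        exists! m : {set point}, [/\ m \in lines, x \in m & parallel l m];
  noncollinear : exists x y z : point, [/\ x != y, x != z, y != z &
        forall l : {set point}, l \in lines ->
          ~~ [&& x \in l, y \in l & z \in l]]
}.

Definition has_order (A : affine_plane) (q : nat) : Prop :=
  forall l : {set point A}, l \in lines A -> #|l| = q.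

Section Directions.
Variable A : affine_plane.
Implicit Types (l : {set point A}) (S T : {set point A}).

Definition parallel_class l : {set {set point A}} :=
  [set m in lines A | parallel l m].

Definition directions : {set {set {set point A}}} :=
  [set parallel_class l | l in lines A].

Definition cross_determines S T (d : {set {set point A}}) : bool :=
  [exists x in S, exists y in T,
     (x != y) && [exists l in d, (x \in l) && (y \in l)]].

Definition determines S (d : {set {set point A}}) : bool :=
  [exists x in S, exists y in S,
     (x != y) && [exists l in d, (x \in l) && (y \in l)]].

Definition cross_determined_directions S T : {set {set {set point A}}} :=
  [set d in directions | cross_determines S T d].

Definition determined_directions S : {set {set {set point A}}} :=
  [set d in directions | determines S d].

End Directions.

(* Main.v *)
(** Let s, t, i be the sizes of S, T and their intersection, and let u be the
    number of directions that (S, T) does not cross-determine, so that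
    2u >= q + 1.  Give each line l the weights q|S :&: l| - s and
    e_l (q|T :&: l| - t), where the sign e_l is +1 if the direction of l is
    cross-determined and -1 otherwise.  On an undetermined direction
    the sum of |S :&: l||T :&: l| is just i, while over all lines it is
    qi + st.  Hence the Cauchy-Schwarz inequality over all lines reads
      [(2u - 1)st - q(2u - q)i]^2 <= st(q^2 - s)(q^2 - t).
    If st >= q^2, then qi <= st because i^2 <= st, so the left-hand side is at
    least ((q - 1)st)^2; this forces s + t <= 2q, hence s = t = q, and
    substituting back gives i = q. *)

Require Import Defs.
From mathcomp Require Import all_boot.
From mathcomp Require Import all_order all_algebra zify ring.

Set Implicit Arguments.
Unset Strict Implicit.
Unset Printing Implicit Defensive.

Import Order.TTheory GRing.Theory Num.Theory.

Section AffinePlane.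
Variable A : affine_plane.
Implicit Types (x y : point A) (l m n : {set point A}) (S T : {set point A}).
Implicit Types (L : {set {set point A}}).

(** * Lines, parallelism and directions *)

Definition lines_through x := [set l in lines A | x \in l].

Lemma line_unique x y l m : x != y -> l \in lines A -> m \in lines A ->
  x \in l -> y \in l -> x \in m -> y \in m -> l = m.
Proof.
move=> /unique_line[n [_ nU]] lL mL xl yl xm ym.
by rewrite -(nU l) // -(nU m).
Qed.

Lemma parallel_refl l : parallel l l.
Proof. by rewrite /parallel eqxx. Qed.

Lemma parallel_sym l m : parallel l m = parallel m l.
Proof. by rewrite /parallel eq_sym disjoint_sym. Qed.

Lemma parallel_meet l m x : parallel l m -> x \in l -> x \in m -> l = m.
Proof.
case/orP=> [/eqP //|/pred0P/(_ x) /= + xl xm].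
by rewrite xl xm.
Qed.

(** If [l] and [n] share a point off [m], both are the unique parallel to [m] through it; if that
    point lies on [m], all three lines coincide. *)
Lemma parallel_trans l m n : l \in lines A -> m \in lines A -> n \in lines A ->
  parallel l m -> parallel m n -> parallel l n.
Proof.
move=> lL mL nL lm mn.
have [|/pred0Pn[x /andP[/= xl xn]]] := boolP [disjoint l & n].
  by rewrite /parallel => ->; rewrite orbT.
have [xm|xNm] := boolP (x \in m).
  by rewrite (parallel_meet lm xl xm) (parallel_meet mn xm xn) parallel_refl.
have [k [_ kU]] := unique_parallel mL xNm.
by rewrite -(kU l) ?(kU n) ?parallel_refl //; split; rewrite // parallel_sym.
Qed.

Lemma directions_partition : partition (directions A) (lines A).
Proof.
apply: equivalence_partitionP => l m n lL mL nL.
split=> [|lm]; first exact: parallel_refl.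
apply/idP/idP; last exact: parallel_trans.
by apply: parallel_trans; rewrite // parallel_sym.
Qed.

Lemma direction_sub d l : d \in directions A -> l \in d -> l \in lines A.
Proof. by case/imsetP=> m _ ->; rewrite inE => /andP[]. Qed.

Lemma direction_parallel d l m :
  d \in directions A -> l \in d -> m \in d -> parallel l m.
Proof.
case/imsetP=> n nL ->; rewrite !inE => /andP[lL nl] /andP[mL nm].
by apply: (@parallel_trans _ n); rewrite // parallel_sym.
Qed.

Lemma direction_class d l :
  d \in directions A -> l \in d -> parallel_class l = d.
Proof.
case/imsetP=> m mL ->; rewrite inE => /andP[lL ml].
apply/setP=> n; rewrite !inE; case: (boolP (n \in lines A)) => //= nL.
apply/idP/idP; apply: parallel_trans => //.
by rewrite parallel_sym.
Qed.

Lemma card_direction_point d x :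
  d \in directions A -> #|[set l in d | x \in l]| = 1.
Proof.
move=> dD; apply/eqP/cards1P.
suff [m md xm]: exists2 m, m \in d & x \in m.
  exists m; apply/setP=> l; rewrite !inE; apply/andP/eqP => [[ld xl]|-> //].
  exact: parallel_meet (direction_parallel dD ld md) xl xm.
case/imsetP: dD => n nL ->.
have [xn|/(unique_parallel nL)[m [[mL xm nm] _]]] := boolP (x \in n).
  by exists n; rewrite // inE nL parallel_refl.
by exists m; rewrite // inE mL.
Qed.

Lemma card_lines_through2 x y :
  x != y -> #|[set l in lines A | (x \in l) && (y \in l)]| = 1.
Proof.
move=> /unique_line[n [[nL xn yn] nU]]; apply/eqP/cards1P; exists n.
apply/setP=> l; rewrite !inE; apply/idP/eqP => [/and3P[lL xl yl]|->].
  by rewrite (nU l).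
by rewrite nL xn.
Qed.

(** * Double counting of incidences *)

Lemma sum_card_meet L S :
  \sum_(l in L) #|S :&: l| = \sum_(x in S) #|[set l in L | x \in l]|.
Proof.
transitivity (\sum_(l in L) \sum_(x in S | x \in l) 1).
  by apply: eq_bigr => l _; rewrite -sum1_card; apply: eq_bigl => x;
    rewrite inE.
rewrite (exchange_big_dep (mem S)) /=; last by move=> l x _ /andP[].
apply: eq_bigr => x xS; rewrite -sum1_card.
by apply: eq_bigl => l; rewrite inE xS.
Qed.

Lemma sum_card_meet2 L S T :
  \sum_(l in L) #|S :&: l| * #|T :&: l| =
  \sum_(x in S) \sum_(y in T) #|[set l in L | (x \in l) && (y \in l)]|.
Proof.
transitivity (\sum_(x in S) \sum_(l in [set l in L | x \in l]) #|T :&: l|).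
  transitivity (\sum_(l in L) \sum_(x in S | x \in l) #|T :&: l|).
    apply: eq_bigr => l _; rewrite sum_nat_const; congr (_ * _).
    by apply: eq_card => x; rewrite !inE.
  rewrite (exchange_big_dep (mem S)) /=; last by move=> l x _ /andP[].
  apply: eq_bigr => x xS; apply: eq_bigl => l; by rewrite inE xS.
apply: eq_bigr => x _; rewrite sum_card_meet; apply: eq_bigr => y _.
by apply: eq_card => l; rewrite !inE andbA.
Qed.

Lemma sum_card_direction d S :
  d \in directions A -> \sum_(l in d) #|S :&: l| = #|S|.
Proof.
move=> dD; rewrite sum_card_meet -sum1_card.
by apply: eq_bigr => x _; rewrite card_direction_point.
Qed.

(** A line of [d] through distinct points of [S] and [T] would make [d] cross-determined, so only
    the pairs with [x = y] contribute, each on exactly one line of [d]. *)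
Lemma sum_card_meet2_undetermined d S T :
  d \in directions A -> ~~ cross_determines S T d ->
  \sum_(l in d) #|S :&: l| * #|T :&: l| = #|S :&: T|.
Proof.
move=> dD dN; rewrite sum_card_meet2 -sum1_card.
rewrite [RHS](eq_bigl (fun x => (x \in S) && (x \in T))); last first.
  by move=> x; rewrite inE.
rewrite big_mkcondr /=; apply: eq_bigr => x xS.
transitivity (\sum_(y in T) (x == y) : nat).
  apply: eq_bigr => y yT; have [<-|xy] := eqVneq x y.
    rewrite /= -[RHS](card_direction_point x dD); apply: eq_card => l.
    by rewrite !inE andbb.
  apply/eqP; rewrite cards_eq0; apply: contraR dN => /set0Pn[l].
  rewrite inE => /andP[ld xyl].
  apply/existsP; exists x; rewrite xS; apply/existsP; exists y.
  by rewrite yT xy; apply/existsP; exists l; rewrite ld.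
have [xT|xNT] := boolP (x \in T).
  rewrite (bigD1 x) //= eqxx big1 // => y /andP[_].
  by rewrite eq_sym => /negbTE->.
by rewrite big1 // => y yT; case: eqP => // xy; rewrite xy yT in xNT.
Qed.

(** * Counting lines, points and directions *)

Lemma exists_line_avoiding x : exists2 l, l \in lines A & x \notin l.
Proof.
have [a [b [c [ab ac bc abcN]]]] := noncollinear A.
have [l1 [[l1L al1 bl1] _]] := unique_line ab.
have [l2 [[l2L al2 cl2] _]] := unique_line ac.
have [l3 [[l3L bl3 cl3] _]] := unique_line bc.
have [xl1|] := boolP (x \in l1); last by exists l1.
have [xl2|] := boolP (x \in l2); last by exists l2.
have [xl3|] := boolP (x \in l3); last by exists l3.
(* Now [x] lies on all three sides of the triangle: [x = a] puts [a] on the side [l3], and [x != a]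
   makes the sides [l1] and [l2] coincide. *)
have [xa|xa] := eqVneq x a.
  by have := abcN _ l3L; rewrite -xa xl3 bl3 cl3.
have l12 : l1 = l2 by apply: (line_unique xa).
by have := abcN _ l1L; rewrite al1 bl1 l12 cl2.
Qed.

Variable q : nat.
Hypothesis Aq : has_order A q.

Lemma order_gt1 : 1 < q.
Proof.
have [a [b [_ [ab _ _ _]]]] := noncollinear A.
have [l [[lL al bl] _]] := unique_line ab.
by rewrite -(Aq lL); apply/card_gt1P; exists a, b.
Qed.

(** Fix a line [l] missing [x]. Apart from the parallel to [l], the lines through [x] correspond to
    the [q] points of [l]. *)
Lemma card_lines_through x : #|lines_through x| = q + 1.
Proof.
have [l lL xNl] := exists_line_avoiding x.
have [p [[pL xp lp] pU]] := unique_parallel lL xNl.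
have pl : [disjoint l & p].
  by case/orP: lp => // /eqP lp; rewrite lp xp in xNl.
have px : p \in lines_through x by rewrite inE pL.
rewrite (cardsD1 p) px addnC; congr (_ + _).
have -> : #|lines_through x :\ p| =
    \sum_(m in lines_through x :\ p) #|l :&: m|.
  rewrite -sum1_card; apply: eq_bigr => m; rewrite !inE => /and3P[mp mL xm].
  apply/esym/eqP/cards1P.
  have [y /andP[yl ym]]: exists y, (y \in l) && (y \in m).
    apply/existsP; apply: contraNT mp => /existsPn lm; apply/eqP.
    apply/esym/pU; split=> //; apply/orP; right; apply/pred0P => y.
    exact: negbTE (lm y).
  exists y; apply/setP=> z; rewrite !inE; apply/andP/eqP => [[zl zm]|-> //].
  apply/eqP; apply: contraNT xNl => zy.
  by rewrite (line_unique zy lL mL).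
have lp0 : #|l :&: p| = 0 by apply/eqP; rewrite cards_eq0 setI_eq0.
transitivity (\sum_(m in lines_through x) #|l :&: m|).
  by rewrite [RHS](big_setD1 p) //= lp0.
rewrite sum_card_meet -(Aq lL) -sum1_card; apply: eq_bigr => y yl.
have xy : x != y by apply: contraNneq xNl => ->.
rewrite -(card_lines_through2 xy); apply: eq_card => m.
by rewrite !inE andbA.
Qed.

(** The [q + 1] lines through a point [x] carry [q] points each; together they count [x] itself
    [q + 1] times and every other point once. *)
Lemma card_points : #|point A| = q ^ 2.
Proof.
have [x _] := noncollinear A.
have : \sum_(l in lines_through x) #|setT :&: l| = (q + 1) * q.
  rewrite -(card_lines_through x) -sum_nat_const; apply: eq_bigr => l.
  by rewrite inE setTI => /andP[/Aq].
rewrite sum_card_meet (bigD1 x) //= => sumE.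
have : \sum_(y | y != x) #|[set l in lines_through x | y \in l]| =
    #|point A|.-1.
  rewrite -(cardC1 x) -sum1_card; apply: eq_big => [y|y yx].
    by rewrite !inE.
  rewrite -(@card_lines_through2 x y) 1?eq_sym //; apply: eq_card => l.
  by rewrite !inE andbA.
have xE : #|[set l in lines_through x | x \in l]| = q + 1.
  rewrite -(card_lines_through x); apply: eq_card => l.
  by rewrite !inE -andbA andbb.
have : 0 < #|point A| by apply/card_gt0P; exists x.
move: sumE; rewrite xE (eq_bigl (fun y => y != x)) => [+ P0 P1|y]; last first.
  by rewrite inE.
rewrite P1 => sumE.
by rewrite -mulnn; move: #|point A| P0 sumE => p; nia.
Qed.

Lemma card_direction d : d \in directions A -> #|d| = q.
Proof.
move=> dD; have := sum_card_direction setT dD.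
rewrite cardsT card_points.
rewrite (eq_bigr (fun=> q)) => [|l ld]; last first.
  by rewrite setTI Aq // (direction_sub dD ld).
rewrite sum_nat_const; have := order_gt1; nia.
Qed.

(** Each direction contains exactly one of the [q + 1] lines through a fixed point. *)
Lemma card_directions : #|directions A| = q + 1.
Proof.
have [x _] := noncollinear A.
rewrite -(card_lines_through x) -[RHS]sum1_card -[LHS]sum1_card.
rewrite [RHS](eq_bigl (fun l => (l \in lines A) && (x \in l))); last first.
  by move=> l; rewrite inE.
rewrite big_mkcondr (set_partition_big _ directions_partition) /=.
apply: eq_bigr => d dD; rewrite -big_mkcondr /=.
rewrite -[LHS](card_direction_point x dD) -sum1_card.
by apply: eq_bigl => l; rewrite inE.
Qed.

Lemma sum_card_meet2_lines S T :
  \sum_(l in lines A) #|S :&: l| * #|T :&: l| = q * #|S :&: T| + #|S| * #|T|.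
Proof.
rewrite sum_card_meet2.
transitivity (\sum_(x in S) ((x \in T) * q + #|T|)).
  apply: eq_bigr => x xS.
  (* Distinct points share one line, while a point lies on [q + 1] lines: hence the extra [q] on the
     diagonal. *)
  transitivity (\sum_(y in T) ((y == x) * q + 1)).
    apply: eq_bigr => y yT; have [->|yx] := eqVneq y x.
      rewrite mul1n -(card_lines_through x); apply: eq_card => l.
      by rewrite !inE andbb.
    by rewrite card_lines_through2 // eq_sym.
  rewrite big_split /= sum1_card; congr (_ + _).
  rewrite -big_distrl /=; congr (_ * _).
  have [xT|xNT] := boolP (x \in T).
    rewrite (bigD1 x) //= eqxx big1 // => y /andP[_].
    by move=> /negbTE->.
  by rewrite big1 // => y yT; case: eqP => // yx; rewrite -yx yT in xNT.
rewrite big_split /= sum_nat_const -big_distrl /= mulnC; congr (_ * _ + _).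
rewrite -sum1_card [RHS](eq_bigl (fun x => (x \in S) && (x \in T))).
  by rewrite big_mkcondr /=; apply: eq_bigr => x _; case: (x \in T).
by move=> x; rewrite inE.
Qed.

(** * Deviations from the mean and their signed sum *)

Local Open Scope ring_scope.

(* The deviation of [#|S :&: l|] from its mean [#|S| / q] over a parallel class,
   scaled by [q] to stay in the integers. *)
Definition deviation S l : int := q%:R * #|S :&: l|%:R - #|S|%:R.

Lemma sum_deviation2_direction d S T : d \in directions A ->
  \sum_(l in d) deviation S l * deviation T l =
  q%:R ^+ 2 * (\sum_(l in d) #|S :&: l| * #|T :&: l|)%N%:R
    - q%:R * #|S|%:R * #|T|%:R.
Proof.
move=> dD.
rewrite (eq_bigr (fun l => q%:R ^+ 2 * (#|S :&: l| * #|T :&: l|)%N%:R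
  - q%:R * #|T|%:R * #|S :&: l|%:R - q%:R * #|S|%:R * #|T :&: l|%:R
  + #|S|%:R * #|T|%:R)); last by move=> l _; rewrite /deviation natrM; ring.
rewrite big_split /= !sumrB -!mulr_sumr -!natr_sum !sum_card_direction //.
rewrite sumr_const card_direction // -mulr_natr; ring.
Qed.

Lemma sum_deviation2_lines S T :
  \sum_(d in directions A) \sum_(l in d) deviation S l * deviation T l =
  q%:R ^+ 3 * #|S :&: T|%:R - q%:R * #|S|%:R * #|T|%:R.
Proof.
rewrite (eq_bigr _ (fun d => @sum_deviation2_direction d S T)).
rewrite sumrB -mulr_sumr -natr_sum.
rewrite -(set_partition_big _ directions_partition) /= sum_card_meet2_lines.
rewrite sumr_const card_directions -mulr_natr !natrD !natrM; ring.
Qed.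

Lemma sum_sqr_deviation S : \sum_(l in lines A) deviation S l ^+ 2 =
  q%:R * #|S|%:R * (q%:R ^+ 2 - #|S|%:R).
Proof.
rewrite (set_partition_big _ directions_partition) /=.
transitivity
  (\sum_(d in directions A) \sum_(l in d) deviation S l * deviation S l).
  by apply: eq_bigr => d _; apply: eq_bigr => l _; rewrite expr2.
rewrite sum_deviation2_lines setIid; ring.
Qed.

Definition cross_sign S T l : int :=
  if parallel_class l \in cross_determined_directions S T then 1 else -1.

Lemma sum_signed_deviation S T :
  let u := #|directions A :\: cross_determined_directions S T| in
  \sum_(l in lines A) deviation S l * (cross_sign S T l * deviation T l) =
  q%:R * ((2 * u%:R - 1) * #|S|%:R * #|T|%:R
          - q%:R * (2 * u%:R - q%:R) * #|S :&: T|%:R).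
Proof.
move=> u; set C := cross_determined_directions S T in u *.
pose F (d : {set {set point A}}) := \sum_(l in d) deviation S l * deviation T l.
rewrite (set_partition_big _ directions_partition) /=.
(* The signed sum is the full sum minus twice the part over the directions outside [C], each of
   which contributes the same amount. *)
transitivity
  (\sum_(d in directions A) (F d - 2 * (if d \in C then 0 else F d))).
  apply: eq_bigr => d dD.
  rewrite (eq_bigr (fun l => (if d \in C then 1 else -1) *
                             (deviation S l * deviation T l))).
    by rewrite -mulr_sumr -/(F d); case: (d \in C); ring.
  by move=> l ld; rewrite /cross_sign (direction_class dD ld) -/C; ring.
rewrite sumrB sum_deviation2_lines -mulr_sumr.
have -> : \sum_(d in directions A) (if d \in C then 0 else F d) =
    u%:R * (q%:R ^+ 2 * #|S :&: T|%:R - q%:R * #|S|%:R * #|T|%:R).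
  rewrite mulr_natl -sumr_const.
  rewrite [RHS](eq_bigl (fun d => (d \in directions A) && (d \notin C))).
    rewrite [RHS]big_mkcondr; apply: eq_bigr => d dD /=.
    have [//|dN] := boolP (d \in C).
    rewrite /F sum_deviation2_direction // sum_card_meet2_undetermined //.
    by apply: contra dN; rewrite inE dD.
  by move=> d; rewrite inE andbC.
ring.
Qed.

End AffinePlane.

(** * The Cauchy-Schwarz bound *)

Local Open Scope ring_scope.

Lemma sum_Cauchy_Schwarz (R : realDomainType) (I : finType) (P : pred I)
    (f g : I -> R) :
  (\sum_(i | P i) f i * g i) ^+ 2 <=
  (\sum_(i | P i) f i ^+ 2) * (\sum_(i | P i) g i ^+ 2).
Proof.
set a := \sum_(i | P i) f i ^+ 2; set b := \sum_(i | P i) g i ^+ 2.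
set c := \sum_(i | P i) f i * g i.
have a_ge0 : 0 <= a by apply: sumr_ge0 => i _; apply: sqr_ge0.
have [a0|a_neq0] := eqVneq a 0.
  suff -> : c = 0 by rewrite a0 mul0r expr0n.
  apply: big1 => i Pi; apply/eqP; rewrite mulf_eq0 -[f i == 0]sqrf_eq0.
  move/eqP: a0; rewrite psumr_eq0 => [/allP/(_ i)|j _]; last exact: sqr_ge0.
  by rewrite mem_index_enum Pi => /(_ isT) /= ->.
(* This sum of squares expands to [a * (a * b - c ^+ 2)], and [a] is positive here. *)
have : 0 <= \sum_(i | P i) (a * g i - c * f i) ^+ 2.
  by apply: sumr_ge0 => i _; apply: sqr_ge0.
rewrite (eq_bigr (fun i => a ^+ 2 * g i ^+ 2 - 2 * a * c * (f i * g i)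
                           + c ^+ 2 * f i ^+ 2)); last by move=> i _; ring.
rewrite big_split /= sumrB -!mulr_sumr -/a -/b -/c.
have -> : a ^+ 2 * b - 2 * a * c * c + c ^+ 2 * a = a * (a * b - c ^+ 2).
  by ring.
by rewrite pmulr_rge0 ?subr_ge0 // lt_def a_neq0.
Qed.

Lemma cross_inequality (A : affine_plane) (q : nat) (Aq : has_order A q)
    (S T : {set point A}) :
  let u : int := #|directions A :\: cross_determined_directions S T|%:R in
  let s : int := #|S|%:R in let t : int := #|T|%:R in
  let n : int := q%:R in
  ((2 * u - 1) * (s * t) - n * (2 * u - n) * #|S :&: T|%:R) ^+ 2 <=
  s * t * ((n ^+ 2 - s) * (n ^+ 2 - t)).
Proof.
rewrite /=; set u : int := #|_ :\: _|%:R.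
set s : int := #|S|%:R; set t : int := #|T|%:R; set n : int := q%:R.
have n_gt0 : 0 < n by rewrite ltr0n (ltn_trans _ (order_gt1 Aq)).
have := sum_Cauchy_Schwarz (mem (lines A)) (deviation q S)
  (fun l => cross_sign S T l * deviation q T l).
rewrite (sum_signed_deviation Aq) (sum_sqr_deviation Aq).
(* The signs square to 1, so they leave this factor unchanged. *)
rewrite (eq_bigr (fun l => deviation q T l ^+ 2)) => [|l _]; last first.
  by rewrite exprMn /cross_sign; case: ifP; rewrite ?sqrrN expr1n mul1r.
rewrite (sum_sqr_deviation Aq) -/u -/s -/t -/n exprMn.
have -> : n * s * (n ^+ 2 - s) * (n * t * (n ^+ 2 - t)) =
  n ^+ 2 * (s * t * ((n ^+ 2 - s) * (n ^+ 2 - t))) by ring.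
by rewrite ler_pM2l ?exprn_gt0 // -[(_ - 1) * _ * _]mulrA.
Qed.

(** * Arithmetic of the extremal case *)

Lemma extremal_sizes (n u s t i : int) :
  2 <= n -> n + 1 <= 2 * u -> 0 <= i -> i <= s -> i <= t ->
  ((2 * u - 1) * (s * t) - n * (2 * u - n) * i) ^+ 2 <=
    s * t * ((n ^+ 2 - s) * (n ^+ 2 - t)) ->
  n ^+ 2 <= s * t -> [/\ s = n, t = n & i = n].
Proof.
move=> n2 nu i0 ils ilt W st.
have st_gt0 : 0 < s * t by nia.
have i2 : i ^+ 2 <= s * t by nia.
have ni : n * i <= s * t.
  rewrite -ler_sqr ?nnegrE ?mulr_ge0 //; try lia.
  rewrite exprMn [leRHS]expr2; apply: ler_pM => //; exact: sqr_ge0.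
(* As [2 * u - n] is positive, [ni] bounds the subtracted term by [(2 * u - n) * (s * t)]. *)
have lb : (n - 1) * (s * t) <= (2 * u - 1) * (s * t) - n * (2 * u - n) * i.
  nia.
have W1 : ((n - 1) * (s * t)) ^+ 2 <= s * t * ((n ^+ 2 - s) * (n ^+ 2 - t)).
  apply: le_trans W; rewrite ler_sqr ?nnegrE //; nia.
have W2 : (n - 1) ^+ 2 * (s * t) <= (n ^+ 2 - s) * (n ^+ 2 - t).
  rewrite -(ler_pM2l st_gt0); apply: le_trans W1.
  by rewrite le_eqVlt; apply/orP; left; apply/eqP; ring.
(* Expanding [W2] gives [n ^+ 2 * (s + t) <= n ^+ 4 - n * (n - 2) * (s * t)]; then [n ^+ 2 <= s * t]
   applies, since [n >= 2]. *)
have sum_le : s + t <= 2 * n.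
  have : n ^+ 2 * (s + t) <= n ^+ 2 * (2 * n) by nia.
  by rewrite ler_pM2l // exprn_gt0 //; lia.
have st0 : (s - t) ^+ 2 <= 0.
  have -> : (s - t) ^+ 2 = (s + t) ^+ 2 - 4 * (s * t) by ring.
  have : (s + t) ^+ 2 <= (2 * n) ^+ 2 by rewrite ler_sqr ?nnegrE //; lia.
  by rewrite exprMn; lia.
have ts : t = s.
  by apply/esym/eqP; rewrite -subr_eq0 -sqrf_eq0 eq_le st0 sqr_ge0.
have sn : s = n.
  apply/eqP; rewrite eq_le -[n <= s]ler_sqr ?nnegrE; [|lia|lia].
  by rewrite [s ^+ 2]expr2 -{3}ts st andbT; lia.
split=> //; first by rewrite ts.
move: W; rewrite ts sn => W.
(* With [s = t = n] the right side of [W] is the square of [n * (n ^+ 2 - n)], and by [lb] the root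
   on the left is nonnegative. *)
have Wn : (2 * u - 1) * (n * n) - n * (2 * u - n) * i <= n * (n ^+ 2 - n).
  rewrite -ler_sqr ?nnegrE; first last.
  - by rewrite mulr_ge0 ?subr_ge0 ?expr2 ?ler_peMl; lia.
  - by move: lb; rewrite ts sn; apply: le_trans; rewrite !mulr_ge0; lia.
  apply: le_trans W _; rewrite le_eqVlt; apply/orP; left; apply/eqP; ring.
(* Cancelling the positive factor [n * (2 * u - n)] leaves [n <= i]. *)
have : n * (2 * u - n) * n <= n * (2 * u - n) * i.
  have -> : n * (2 * u - n) * n = (2 * u - 1) * (n * n) - n * (n ^+ 2 - n).
    by ring.
  by rewrite lerBlDl -lerBlDr.
rewrite ler_pM2l; last by rewrite mulr_gt0; lia.
by move=> ni'; apply/eqP; rewrite eq_le ni' -[in X in _ <= X]sn ils.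
Qed.

Local Close Scope ring_scope.

Theorem theorem1p9 (A : affine_plane) (q : nat) (Aq : has_order A q)
    (S T : {set point A}) (c : nat)
    (cE : #|cross_determined_directions S T| = c)
    (c_le : 2 * c <= q + 1) :
  #|S| * #|T| <= q ^ 2 /\
  (#|S| * #|T| = q ^ 2 ->
     [/\ S = T, #|S| = q & #|determined_directions S| = c]).
Proof.
have uE : #|directions A :\: cross_determined_directions S T| = q + 1 - c.
  rewrite cardsD -cE -(card_directions Aq); congr (_ - _).
  by apply: eq_card => d; rewrite !inE; case: (d \in directions A).
(* The hypothesis on [c] enters here, as [q + 1 <= 2 * (q + 1 - c)]. *)
have extremal : q ^ 2 <= #|S| * #|T| ->
    [/\ #|S| = q, #|T| = q & #|S :&: T| = q].
  move=> st; have := cross_inequality Aq S T; rewrite /= uE => W.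
  have := order_gt1 Aq => q2.
  have IS := subset_leq_card (subsetIl S T).
  have IT := subset_leq_card (subsetIr S T).
  rewrite !natz in W.
  have [||||||[->] [->] [->] //] := extremal_sizes _ _ _ _ _ W; lia.
split=> [|st].
  rewrite leqNgt; apply/negP => st; have [Sq Tq _] := extremal (ltnW st).
  by rewrite Sq Tq mulnn ltnn in st.
have [|Sq Tq STq] := extremal; first by rewrite st.
(* The intersection has as many points as [S] and as [T], so it equals both. *)
have ST : S = T.
  have /eqP <- : S :&: T == S by rewrite eqEcard subsetIl STq Sq /=.
  by apply/eqP; rewrite eqEcard subsetIr STq Tq /=.
(* For [T = S], cross-determining and determining a direction agree by definition. *)
by split=> //; rewrite -cE -ST.
Qed.
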